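(* The solution functor $\mathcal W^{\mathrm P}_r:\mathbf{roPG}\to\mathbb S^{\mathbb P}_r$ is a traced symmetric monoidal functor. In particular, $\mathcal W^{\mathrm P}_r(\mathcal C;\mathcal D)=\mathcal W^{\mathrm P}_r(\mathcal C);\mathcal W^{\mathrm P}_r(\mathcal D)$, $\mathcal W^{\mathrm P}_r(\mathcal C\oplus\mathcal D)=\mathcal W^{\mathrm P}_r(\mathcal C)\oplus\mathcal W^{\mathrm P}_r(\mathcal D)$, and $\mathcal W^{\mathrm P}_r(\mathrm{tr}^l_{m,n}(\mathcal E))=\mathrm{tr}^l_{m,n}(\mathcal W^{\mathrm P}_r(\mathcal E))$ for all roPGs $\mathcal C,\mathcal D,\mathcal E$ of appropriate types.
   Context: Notation: $[k]=\{1,\dots,k\}$ ($[0]=\emptyset$); $X+Y$ disjoint union; composition diagrammatic $;$. An roMPG $\mathcal A:m\to n$ is a tuple $(m,n,Q,E,\rho,w)$: $Q$ finite set of positions, entrances $[m]$, exits $[n]$ (pairwise disjoint with $Q$), edges $E\subseteq([m]+Q)\times([n]+Q)$ with each entrance having exactly one successor and each exit at most one predecessor, roles $\rho:Q\to\{\exists,\forall\}$, weights $w:Q\to\mathbb R$. An roPG (rightward open play graph) is an roMPG in which every element of $[m]+Q$ has at most one successor. Operations: for $\mathcal C:m\to l$, $\mathcal D:l\to n$, $\mathcal C;\mathcal D:m\to n$ has positions $Q^{\mathcal C}+Q^{\mathcal D}$ with inherited roles/weights and edges: those of $\mathcal C$ from $[m]+Q^{\mathcal C}$ to $Q^{\mathcal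 C}$; those of $\mathcal D$ from $Q^{\mathcal D}$ to $[n]+Q^{\mathcal D}$; $(s,s')$, $s\in[m]+Q^{\mathcal C}$, $s'\in[n]+Q^{\mathcal D}$, whenever some $i\in[l]$ has $(s,i)\in E^{\mathcal C}$, $(i,s')\in E^{\mathcal D}$. $\mathcal C\oplus\mathcal D$ is the disjoint union with the second component's entrances/exits shifted by the first's numbers of entrances/exits. For $\mathcal E:l+m\to l+n$, $\mathrm{tr}^l_{m,n}(\mathcal E):m\to n$ has the same positions, roles, weights, and $(s,s')\in([m]+Q)\times([n]+Q)$ is an edge iff there are $k\ge0$, $i_1,..,i_k\in[l]$ with $(\hat s,i_1),(i_1,i_2),\dots,(i_k,\hat s')\in E^{\mathcal E}$ ($k=0$: $(\hat s,\hat s')\in E^{\mathcal E}$), $i_j$ read as exit when target and entrance when source, $\hat s=l+s$ for open ends and $\hat s=s$ for positions. $\mathrm{id}_m$: no positions, edges $(i,i)$; $\sigma_{m,n}:m+n\to n+m$: no positions, edges $(i,n+i)$, $(m+j,j)$. $\mathbf{roPG}$ is the category with objects $\mathbb N$ and arrows roPGs up to isomorphism (bijection of positions preserving edges, roles, weights and fixing open ends), with these operations; it is a traced symmetric monoidal category. Plays: for an roPG $\mathcal C:m\to n$ and $i\in[m]$, $\pi^{\mathcal C}_i=(s_j)_{j\in J}$ ($J=\{0..M\}$ or $\mathbb N$) is the unique maximal sequence with $s_0=i$ and $(s_j,s_{j+1})\in E$. MP condition for infinite plays: $\liminf_N\frac1N\sum_{j=1}^Nw(s_j)\ge0$. $T(X)=X+\mathbb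 R\times X+\{\exists^*,\forall^*\}$. Denotation $[\![\pi]\!]\in T([n])$: $s_1$ if $J=\{0,1\}$ and $s_1$ is an exit; $(\sum_{j=1}^{M-1}w(s_j),s_M)$ if $M\ge2$ and $s_M$ an exit; $\exists^*$ if $J$ finite and $s_M$ a $\forall$-position, or $J$ infinite satisfying MP; $\forall^*$ if $J$ finite and $s_M$ an $\exists$-position, or $J$ infinite failing MP. $\mathbb S^{\mathbb P}_r$: objects $\mathbb N$; arrows $f:m\to n$ are functions $[m]\to T([n])$ such that if $f(i)=k\in[n]$ then for all $j\ne i$, $f(j)\ne k$ and $f(j)\ne(r,k)$ for all $r$. $(f;g)(i)=f(i)$ if $f(i)\in\{\exists^*,\forall^*\}$; $g(j)$ if $f(i)=j$; $g(j)$ if $f(i)=(r,j)$, $g(j)\in\{\exists^*,\forall^*\}$; $(r,k)$ if $f(i)=(r,j)$, $g(j)=k$; $(r+r',k)$ if $f(i)=(r,j)$, $g(j)=(r',k)$. $\mathrm{id}(i)=i$; $\sigma_{m,n}(i)=n+i$ ($i\le m$), $\sigma_{m,n}(m+j)=j$; $(f\oplus g)(i)=f(i)$ ($i\le m$), $(f\oplus g)(m+i)$ is $g(i)$ with its index $j$ (if any) shifted to $n+j$. Trace of $f:l+m\to l+n$ at $i\in[m]$: $v_0=l+i$; if $j=0$ or $v_j\in[l]$ then $v_{j+1}=f(v_j)$; if $v_j=(r,k)$, $k\in[l]$, then $v_{j+1}=f(k)$; otherwise stop at $v_j$. If finite $(v_0,..,v_K)$, with $S$ the sum of first components of $v_j\in\mathbb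 R\times[l+n]$, $1\le j\le K$: result $v_K$ if $v_K\in\{\exists^*,\forall^*\}$; $k$ if $v_K=l+k$ and no earlier $v_j$ carries a weight; $(S,k)$ if $v_K=l+k$ and some earlier $v_j$ carries a weight; $(S,k)$ if $v_K=(r,l+k)$. If infinite, with $w'_1,w'_2,..$ the first components of the (infinitely many) entries in $\mathbb R\times[l]$: $\exists^*$ if $\liminf_N\frac1N\sum_{t\le N}w'_t\ge0$, else $\forall^*$. $\mathcal W^{\mathrm P}_r$ is the identity on objects and sends $\mathcal C:m\to n$ to $i\mapsto[\![\pi^{\mathcal C}_i]\!]$. *)

(* Defs.v *)
From mathcomp Require Import all_boot.
From Stdlib Require Import Reals ClassicalEpsilon.
From Coquelicot Require Import Coquelicot.

Set Implicit Arguments.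
Unset Strict Implicit.
Unset Printing Implicit Defensive.

(* Conventions: open ends are 0-based ordinals: entrance i of [m] is an element
   of 'I_m; the "first" summand [l] of l+m is lshift, the second is rshift. *)

Fixpoint rsum (f : nat -> R) (N : nat) : R :=
  match N with 0 => 0%R | S N' => (rsum f N' + f N')%R end.

(* liminf_N (1/N) sum_{t=1}^N a_t >= 0, for a sequence a_1, a_2, ...
   given as  a : nat -> R  with a_t = a t  (a 0 unused). *)
Definition MP_cond (a : nat -> R) : Prop :=
  Rbar_le (Finite 0%R)
    (LimInf_seq (fun N => (rsum (fun t => a (S t)) N / INR N)%R)).

Inductive T (X : Type) : Type :=
| Tplain : X -> T X
| Tw : R -> X -> T X
| Eany : T X
| Aany : T X.
Arguments Eany {X}.
Arguments Aany {X}.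

Definition Tmap (X Y : Type) (h : X -> Y) (t : T X) : T Y :=
  match t with
  | Tplain x => Tplain (h x)
  | Tw r x => Tw r (h x)
  | Eany => Eany
  | Aany => Aany
  end.

Definition Sarr (m n : nat) := 'I_m -> T 'I_n.

Definition S_arrow (m n : nat) (f : Sarr m n) : Prop :=
  forall (i : 'I_m) (k : 'I_n), f i = Tplain k ->
    forall j : 'I_m, j <> i -> f j <> Tplain k /\ (forall r : R, f j <> Tw r k).

Definition s_comp (m l n : nat) (f : Sarr m l) (g : Sarr l n) : Sarr m n :=
  fun i =>
    match f i with
    | Eany => Eany
    | Aany => Aany
    | Tplain j => g j
    | Tw r j =>
        match g j with
        | Eany => Eany
        | Aany => Aany
        | Tplain k => Tw r k
        | Tw r' k => Tw (r + r')%R k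
        end
    end.

Definition s_id (m : nat) : Sarr m m := fun i => Tplain i.

Definition s_sigma (m n : nat) : Sarr (m + n) (n + m) :=
  fun i => match fintype.split i with
           | inl a => Tplain (rshift n a)
           | inr b => Tplain (lshift m b)
           end.

Definition s_oplus (m n m' n' : nat) (f : Sarr m n) (g : Sarr m' n')
  : Sarr (m + m') (n + n') :=
  fun i => match fintype.split i with
           | inl a => Tmap (fun k => lshift n' k) (f a)
           | inr b => Tmap (fun k => rshift n k) (g b)
           end.

(* Trace in S.  The paper's sequence v_1, v_2, ... is tv f i 0, tv f i 1, ...
   (None = the sequence has already stopped). *)
Definition s_cont (l n : nat) (v : T 'I_(l + n)) : option 'I_l :=
  match v with
  | Tplain k | Tw _ k => match fintype.split k with inl a => Some a | inr _ => None end
  | _ => None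
  end.

Fixpoint tv (l m n : nat) (f : Sarr (l + m) (l + n)) (i : 'I_m) (j : nat)
  : option (T 'I_(l + n)) :=
  match j with
  | 0 => Some (f (rshift l i))
  | S j' => match tv f i j' with
            | Some v => match s_cont v with
                        | Some a => Some (f (lshift m a))
                        | None => None
                        end
            | None => None
            end
  end.

Definition is_weighted (X : Type) (o : option (T X)) : bool :=
  match o with Some (Tw _ _) => true | _ => false end.

Definition wtT (X : Type) (o : option (T X)) : R :=
  match o with Some (Tw r _) => r | _ => 0%R end.

(* Result of a finite trace sequence stopping at v = v_{K+1} (0-based K). *)
Definition s_trace_fin (l m n : nat) (f : Sarr (l + m) (l + n)) (i : 'I_m)
  (K : nat) (v : T 'I_(l + n)) : T 'I_n :=
  let S := rsum (fun j => wtT (tv f i j)) K.+1 in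
  match v with
  | Eany => Eany
  | Aany => Aany
  | Tplain k =>
      match fintype.split k with
      | inr b => if seq.has (fun j => is_weighted (tv f i j)) (seq.iota 0%nat K)
                 then Tw S b else Tplain b
      | inl _ => Eany (* impossible: the sequence would continue *)
      end
  | Tw _ k =>
      match fintype.split k with
      | inr b => Tw S b
      | inl _ => Eany (* impossible *)
      end
  end.

Definition enum_weighted (l m n : nat) (f : Sarr (l + m) (l + n)) (i : 'I_m)
  (phi : nat -> nat) : Prop :=
  (forall t, (phi t < phi t.+1)%nat) /\
  (forall j, is_weighted (tv f i j) <-> exists t, phi t = j).

Definition s_trace_rel (l m n : nat) (f : Sarr (l + m) (l + n)) (i : 'I_m)
  (d : T 'I_n) : Prop :=
  (exists K v, tv f i K = Some v /\ s_cont v = None /\ d = s_trace_fin f i K v)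
  \/
  ((forall K, exists v a, tv f i K = Some v /\ s_cont v = Some a) /\
   let P := exists phi, enum_weighted f i phi /\
              MP_cond (fun t => wtT (tv f i (phi t.-1))) in
   ((P /\ d = Eany) \/ (~ P /\ d = Aany))).

Definition s_trace (l m n : nat) (f : Sarr (l + m) (l + n)) : Sarr m n :=
  fun i => epsilon (inhabits Eany) (s_trace_rel f i).

Inductive role := RE | RA.

Record roG (m n : nat) := ROG {
  pos : finType;
  edge : 'I_m + pos -> 'I_n + pos -> Prop;
  rl : pos -> role;
  wt : pos -> R
}.
Arguments ROG {m n}.
Arguments pos {m n} r.
Arguments edge {m n} r _ _.
Arguments rl {m n} r _.
Arguments wt {m n} r _.

Definition is_roPG (m n : nat) (C : roG m n) : Prop :=
  (forall i : 'I_m, exists y, edge C (inl i) y) /\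
  (forall x y y', edge C x y -> edge C x y' -> y = y') /\
  (forall (k : 'I_n) x x', edge C x (inl k) -> edge C x' (inl k) -> x = x').

Definition sum_map (A A' B B' : Type) (f : A -> A') (g : B -> B') (x : A + B)
  : A' + B' :=
  match x with inl a => inl (f a) | inr b => inr (g b) end.

Definition case_pos (A B C : Type) (f : A -> C) (g : B -> C) (x : A + B) : C :=
  match x with inl a => f a | inr b => g b end.

Definition ro_comp (m l n : nat) (C : roG m l) (D : roG l n) : roG m n :=
  let inC := sum_map (fun i : 'I_m => i) (fun q : pos C => @inl (pos C) (pos D) q) in
  let outD := sum_map (fun k : 'I_n => k) (fun q : pos D => @inr (pos C) (pos D) q) in
  ROG (pos C + pos D)%type
    (fun s s' =>
       (exists x q', s = inC x /\ s' = inr (inl q') /\ edge C x (inr q')) \/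
       (exists q y, s = inr (inr q) /\ s' = outD y /\ edge D (inr q) y) \/
       (exists x y (j : 'I_l), s = inC x /\ s' = outD y /\
                               edge C x (inl j) /\ edge D (inl j) y))
    (case_pos (rl C) (rl D))
    (case_pos (wt C) (wt D)).

Definition ro_oplus (m n m' n' : nat) (C : roG m n) (D : roG m' n')
  : roG (m + m') (n + n') :=
  ROG (pos C + pos D)%type
    (fun s s' =>
       (exists x y, s = sum_map (fun i => lshift m' i) inl x /\
                    s' = sum_map (fun k => lshift n' k) inl y /\ edge C x y) \/
       (exists x y, s = sum_map (fun i => rshift m i) inr x /\
                    s' = sum_map (fun k => rshift n k) inr y /\ edge D x y))
    (case_pos (rl C) (rl D))
    (case_pos (wt C) (wt D)).

Fixpoint tr_chain (l m n : nat) (E : roG (l + m) (l + n))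
  (x : 'I_(l + m) + pos E) (ks : seq 'I_l) (y : 'I_(l + n) + pos E) : Prop :=
  match ks with
  | [::] => edge E x y
  | k :: ks' => edge E x (inl (lshift n k)) /\ tr_chain (inl (lshift m k)) ks' y
  end.

Definition ro_trace (l m n : nat) (E : roG (l + m) (l + n)) : roG m n :=
  ROG (pos E)
    (fun (s : 'I_m + pos E) (s' : 'I_n + pos E) => exists ks : seq 'I_l,
        tr_chain (sum_map (fun i : 'I_m => rshift l i) (fun q : pos E => q) s) ks
                 (sum_map (fun k : 'I_n => rshift l k) (fun q : pos E => q) s'))
    (rl E) (wt E).

Definition ro_id (m : nat) : roG m m :=
  ROG void (fun s s' => exists i : 'I_m, s = inl i /\ s' = inl i)
    (fun q => of_void _ q) (fun q => of_void _ q).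

Definition ro_sigma (m n : nat) : roG (m + n) (n + m) :=
  ROG void
    (fun s s' => (exists i : 'I_m, s = inl (lshift n i) /\ s' = inl (rshift n i)) \/
                 (exists j : 'I_n, s = inl (rshift m j) /\ s' = inl (lshift m j)))
    (fun q => of_void _ q) (fun q => of_void _ q).

Definition ro_iso (m n : nat) (C C' : roG m n) : Prop :=
  exists h : pos C -> pos C', bijective h /\
    (forall x y, edge C x y <-> edge C' (sum_map (fun i : 'I_m => i) h x) (sum_map (fun k : 'I_n => k) h y)) /\
    (forall q, rl C' (h q) = rl C q) /\ (forall q, wt C' (h q) = wt C q).

(* Plays and their denotations.  A play (s_j)_{j in J} from entrance i is
   represented by i (= s_0) and s : nat -> 'I_n + pos C giving s_j for j >= 1
   (s 0 is irrelevant).  Finite plays have J = {0..M}. *)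
Definition wt_of (m n : nat) (C : roG m n) (x : 'I_n + pos C) : R :=
  match x with inr q => wt C q | inl _ => 0%R end.

Definition is_fin_play (m n : nat) (C : roG m n) (i : 'I_m) (M : nat)
  (s : nat -> 'I_n + pos C) : Prop :=
  (1 <= M)%nat /\ edge C (inl i) (s 1%nat) /\
  (forall j, (1 <= j < M)%nat -> exists q, s j = inr q /\ edge C (inr q) (s j.+1)) /\
  ~ (exists q y, s M = inr q /\ edge C (inr q) y).

Definition is_inf_play (m n : nat) (C : roG m n) (i : 'I_m)
  (s : nat -> 'I_n + pos C) : Prop :=
  edge C (inl i) (s 1%nat) /\
  (forall j, (1 <= j)%nat -> exists q, s j = inr q /\ edge C (inr q) (s j.+1)).

Arguments is_fin_play {m n} C i M s.
Arguments is_inf_play {m n} C i s.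

Definition fin_den (m n : nat) (C : roG m n) (M : nat) (s : nat -> 'I_n + pos C)
  : T 'I_n :=
  match s M with
  | inl k => if M == 1%nat then Tplain k
             else Tw (rsum (fun j => wt_of (s j.+1)) M.-1) k
  | inr q => match rl C q with RA => Eany | RE => Aany end
  end.

Definition play_den (m n : nat) (C : roG m n) (i : 'I_m) (d : T 'I_n) : Prop :=
  (exists M s, is_fin_play C i M s /\ d = fin_den M s) \/
  (exists s, is_inf_play C i s /\
     ((MP_cond (fun j => wt_of (s j)) /\ d = Eany) \/
      (~ MP_cond (fun j => wt_of (s j)) /\ d = Aany))).

Definition W (m n : nat) (C : roG m n) : Sarr m n :=
  fun i => epsilon (inhabits Eany) (play_den C i).

Arguments s_id m _ : clear implicits.
Arguments s_sigma m n _ : clear implicits.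
Arguments ro_id m : clear implicits.
Arguments ro_sigma m n : clear implicits.

(* Main.v *)
(* Since a play graph has finitely many positions, an infinite play runs into a
   cycle, and its mean payoff condition holds iff the weight of the cycle is
   nonnegative.  Denotations are thus given by finite walks, which simulations of
   play graphs transport; this yields isomorphisms, sums and compositions.  For
   the trace, an infinite trace sequence is eventually periodic and, as exits have
   at most one predecessor, contains infinitely many weighted entries; one period
   of it is a cycle of the traced graph with the same total weight. *)

From mathcomp Require Import all_boot.
From Stdlib Require Import Reals Lra Classical ClassicalEpsilon FunctionalExtensionality.
From Coquelicot Require Import Coquelicot.
Require Import Defs.

Set Implicit Arguments.
Unset Strict Implicit.
Unset Printing Implicit Defensive.

Local Open Scope nat_scope.

(** [W] and [s_trace] pick their values by [epsilon], so an equation between them requires existence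
    and uniqueness of a denotation. Uniqueness is settled once, from determinism of plays. After
    that, any single derivation of [den] determines the value of [W], and each law amounts to
    constructing a derivation in the compound graph from derivations in its parts, together with
    functionality of the compound edge relation. The obstacle in the trace is that the two mean
    payoff conditions average differently: a weighted entry of the trace sequence bundles a whole
    stretch of positions into one term, and unweighted entries are not counted, so the two liminfs
    may differ in value. Only their signs have to agree, and the weight of one period decides
    both. *)

Lemma pigeonhole_nat (F : finType) (u : nat -> F) :
  exists s t, s < t /\ u s = u t.
Proof.
apply: NNPP => none.
have inj : injective (fun i : 'I_#|F|.+1 => u i).
  move=> i j eq_u; apply/val_inj/eqP/negPn/negP; rewrite neq_ltn /= => lt_ij.
  apply: none; case/orP: lt_ij => lt_ij; first by exists i, j.
  by exists j, i.
by have := leq_card _ inj; rewrite card_ord ltnn.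
Qed.

Lemma least_counterexample (P : nat -> Prop) :
  ~ (forall j, P j) -> exists j, ~ P j /\ forall k, k < j -> P k.
Proof.
move=> notall; apply: NNPP => none; apply: notall => j.
elim/ltn_ind: j => j IHj; apply: NNPP => notPj.
by apply: none; exists j.
Qed.

(** * Finite sums and mean payoff of eventually periodic sequences *)

Lemma rsum_ext (f g : nat -> R) N :
  (forall j, j < N -> f j = g j) -> rsum f N = rsum g N.
Proof.
elim: N => //= N IHN eq_fg; rewrite eq_fg // IHN // => j lt_jN.
exact/eq_fg/ltnW.
Qed.

Lemma rsum_add (f : nat -> R) p N :
  rsum f (p + N) = (rsum f p + rsum (fun j => f (p + j)%nat) N)%R.
Proof.
by elim: N => [|N IHN] /=; rewrite ?addn0 ?addnS /= ?IHN; lra.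
Qed.

Lemma rsum_shift (f : nat -> R) N :
  rsum f N.+1 = (f 0%nat + rsum (fun j => f j.+1) N)%R.
Proof.
rewrite -add1n rsum_add /= Rplus_0_l.
by congr (_ + _)%R.
Qed.

Lemma bounded_below_index (u : nat -> R) n :
  exists B, forall N, N < n -> (Rabs (u N) <= B)%R.
Proof.
elim: n => [|n [B leB]]; first by exists 0%R.
exists (Rmax B (Rabs (u n))) => N; rewrite ltnS leq_eqVlt => /orP[/eqP->|ltN].
  exact: Rmax_r.
by apply: Rle_trans (Rmax_l _ _); apply: leB.
Qed.

(* The deviation of the partial sums from the line of slope r / c is
   eventually periodic, hence bounded. *)
Lemma periodic_rsum_bound (a : nat -> R) p c :
  0 < c -> (forall t, p <= t -> a (t + c) = a t) ->
  exists B, forall N,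
    (Rabs (rsum a N - INR N * (rsum (fun j => a (p + j)%nat) c / INR c)) <= B)%R.
Proof.
move=> c_gt0 per; set r := rsum _ c.
have c_neq0 : INR c <> 0%R by apply: not_0_INR => c0; rewrite c0 in c_gt0.
pose dev N := (rsum a N - INR N * (r / INR c))%R.
have period_sum k : rsum a (p + k + c) = (rsum a (p + k) + r)%R.
  elim: k => [|k IHk]; first by rewrite addn0 rsum_add.
  rewrite addnS addSn /= IHk per ?leq_addr //; lra.
have dev_per N : p <= N -> dev (N + c) = dev N.
  move=> le_pN; rewrite /dev -(subnKC le_pN) period_sum -plusE plus_INR.
  rewrite plus_INR; field; exact: c_neq0.
have [B leB] := bounded_below_index dev (p + c).
exists B; elim/ltn_ind => N IHN.
case: (ltnP N (p + c)) => [|le_N]; first exact: leB.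
have le_cN : c <= N by apply: leq_trans le_N; apply: leq_addl.
rewrite -/(dev N) -(subnK le_cN) dev_per; last by rewrite leq_subRL // addnC.
by apply: IHN; rewrite ltn_subrL c_gt0 (leq_trans c_gt0).
Qed.

Lemma is_lim_seq_div_INR B : is_lim_seq (fun N => B / INR N)%R 0%R.
Proof.
apply: (is_lim_seq_ext (fun N => B * / INR N)%R); first by move=> N.
rewrite -(Rmult_0_r B); apply: (is_lim_seq_scal_l _ B 0%R).
have -> : Finite 0%R = Rbar_inv p_infty by [].
by apply: is_lim_seq_inv; [apply: is_lim_seq_INR|].
Qed.

Lemma MP_cond_ext (a b : nat -> R) :
  (forall t, a t.+1 = b t.+1) -> MP_cond a -> MP_cond b.
Proof.
move=> eq_ab MPa; apply: Rbar_le_trans MPa _.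
apply: LimInf_le; exists 0 => N _; apply: Req_le.
by congr (_ / _)%R; apply: rsum_ext.
Qed.

(** The averages lie above [B / N], which tends to 0. *)
Lemma MP_cond_lower (a : nat -> R) B :
  (forall N, B <= rsum (fun t => a t.+1) N)%R -> MP_cond a.
Proof.
move=> leB; rewrite /MP_cond.
rewrite -(is_LimInf_seq_unique _ _ (is_lim_LimInf_seq _ _ (is_lim_seq_div_INR B))).
apply: LimInf_le; exists 1 => N /leP N_gt0.
apply: Rmult_le_compat_r; last exact: leB.
by apply/Rlt_le/Rinv_0_lt_compat/lt_0_INR/ltP.
Qed.

(** The averages lie below [B / N - e], whose limit is negative. *)
Lemma not_MP_cond_upper (a : nat -> R) B e :
  (0 < e)%R -> (forall N, rsum (fun t => a t.+1) N <= B - e * INR N)%R ->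
  ~ MP_cond a.
Proof.
move=> e_gt0 leB; rewrite /MP_cond => MPa.
have lim_ub : is_lim_seq (fun N => B / INR N + - e)%R (0 + - e)%R.
  by apply: is_lim_seq_plus' (is_lim_seq_div_INR B) (is_lim_seq_const _).
have := is_LimInf_seq_unique _ _ (is_lim_LimInf_seq _ _ lim_ub).
have : Rbar_le (LimInf_seq (fun N => rsum (fun t => a t.+1) N / INR N)%R)
               (LimInf_seq (fun N => B / INR N + - e)%R).
  apply: LimInf_le; exists 1 => N /leP N_gt0.
  have N_pos : (0 < INR N)%R by apply/lt_0_INR/ltP.
  have -> : (B / INR N + - e = (B - e * INR N) / INR N)%R by field; lra.
  apply: Rmult_le_compat_r; last exact: leB.
  exact/Rlt_le/Rinv_0_lt_compat.
move=> le_lim eq_lim; rewrite eq_lim in le_lim.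
have := Rbar_le_trans _ _ _ MPa le_lim => /=; lra.
Qed.

Definition cycle_den (X : Type) (r : R) : T X :=
  if Rle_dec 0 r then Eany else Aany.

(** Think of [a] as [b] with zeros removed. The first [N] terms of [a] sum to the first [phi N]
    terms of [b], which stay within a constant of [phi N] times the mean over a period. If that mean
    is nonnegative, the sums of [a] are bounded below; if it is negative, [N <= phi N] keeps them
    below a line in [N] of negative slope. *)
Lemma MP_cond_subseq (a b : nat -> R) p c (phi : nat -> nat) :
  0 < c -> (forall t, p <= t -> b (t + c) = b t) ->
  (forall N, N <= phi N) ->
  (forall N, rsum (fun t => a t.+1) N = rsum b (phi N)) ->
  MP_cond a <-> (0 <= rsum (fun j => b (p + j)%nat) c)%R.
Proof.
move=> c_gt0 per le_phi sum_ab; set r := rsum (fun j => _) c.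
have c_pos : (0 < INR c)%R by apply/lt_0_INR/ltP.
have [B leB] := periodic_rsum_bound c_gt0 per.
have phi_pos N : (0 <= INR N <= INR (phi N))%R.
  by split; [apply: pos_INR | apply/le_INR/leP].
split=> [MPa | r_ge0].
  case: (Rle_lt_dec 0 r) => // r_lt0; exfalso.
  have e_gt0 : (0 < - (r / INR c))%R.
    by have := Rdiv_neg_pos _ _ r_lt0 c_pos; lra.
  apply: (not_MP_cond_upper (B := B) e_gt0) MPa => N; rewrite sum_ab.
  have := leB (phi N); rewrite -/r => /Rabs_le_between leBN.
  have := phi_pos N; nra.
apply: (@MP_cond_lower _ (- B)%R) => N; rewrite sum_ab.
have := leB (phi N); rewrite -/r => /Rabs_le_between leBN.
have : (0 <= r / INR c)%R by apply: Rdiv_le_0_compat.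
have := phi_pos N; nra.
Qed.

(** * Denotations by finite walks *)

Definition wadd (X : Type) (r : R) (d : T X) : T X :=
  match d with
  | Tplain k => Tw r k
  | Tw r' k => Tw (r + r')%R k
  | Eany => Eany
  | Aany => Aany
  end.

(** [Tbind (f i) g] is convertible to [s_comp f g i], so results about [Tbind] apply to composites
    directly. *)
Definition Tbind (X Y : Type) (d : T X) (g : X -> T Y) : T Y :=
  match d with
  | Tplain j => g j
  | Tw r j => wadd r (g j)
  | Eany => Eany
  | Aany => Aany
  end.

Definition functional_edge m n (C : roG m n) : Prop :=
  forall x y y', edge C x y -> edge C x y' -> y = y'.

Definition dead m n (C : roG m n) (q : pos C) : Prop :=
  ~ exists y, edge C (inr q) y.

Definition dead_den (X : Type) (rho : role) : T X :=
  match rho with RA => Eany | RE => Aany end.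

Inductive walk m n (C : roG m n) : 'I_m + pos C -> R -> pos C -> Prop :=
| walk1 x q : edge C x (inr q) -> walk x (wt C q) q
| walkS x q r q' :
    edge C x (inr q) -> walk (inr q) r q' -> walk x (wt C q + r)%R q'.

(* The denotation of the play from any entrance or position.  As there are
   finitely many positions, an infinite play is a finite walk into a cycle, and
   MP holds iff the weight of that cycle is nonnegative. *)
Inductive den m n (C : roG m n) (x : 'I_m + pos C) : T 'I_n -> Prop :=
| den_plain k : edge C x (inl k) -> den x (Tplain k)
| den_exit r q k : walk x r q -> edge C (inr q) (inl k) -> den x (Tw r k)
| den_dead r q : walk x r q -> dead q -> den x (dead_den _ (rl C q))
| den_cycle r q r' : walk x r q -> walk (inr q) r' q -> den x (cycle_den _ r').

Arguments walk {m n} C x r q.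
Arguments den {m n} C x d.

Lemma walk_trans m n (C : roG m n) x r q r' q' :
  walk C x r q -> walk C (inr q) r' q' -> walk C x (r + r')%R q'.
Proof.
elim=> [{}x {}q edge_xq|{}x q1 {}r {}q edge_xq _ IH] walk'; first exact: walkS.
by rewrite Rplus_assoc; apply: walkS edge_xq (IH walk').
Qed.

Lemma den_wadd m n (C : roG m n) x r q d :
  walk C x r q -> den C (inr q) d -> den C x (wadd r d).
Proof.
move=> walk_xq [k edge_qk|r' q' k walk_qq' edge_q'k|r' q' walk_qq' deadq'|
                r' q' r'' walk_qq' cyc] /=.
- exact: den_exit edge_qk.
- exact: den_exit (walk_trans walk_xq walk_qq') edge_q'k.
- case E: (rl C q') (den_dead (walk_trans walk_xq walk_qq') deadq') => //=.
- have := den_cycle (walk_trans walk_xq walk_qq') cyc.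
  by rewrite /cycle_den; case: Rle_dec.
Qed.

Section Play.
Variables (m n : nat) (C : roG m n) (y0 : 'I_n + pos C).
Hypothesis funC : functional_edge C.

Definition succ (x : 'I_m + pos C) : 'I_n + pos C :=
  epsilon (inhabits y0) (edge C x).

(* Constant from the first exit on, arbitrary after a dead position. *)
Fixpoint play (x : 'I_m + pos C) (j : nat) : 'I_n + pos C :=
  match j with
  | 0 => succ x
  | j'.+1 => match play x j' with
             | inl k => inl k
             | inr q => succ (inr q)
             end
  end.

Definition continues x j :=
  exists q, play x j = inr q /\ edge C (inr q) (play x j.+1).

Lemma edge_succ x y : edge C x y -> edge C x (succ x).
Proof. by move=> edge_xy; apply: epsilon_spec; exists y. Qed.

Lemma succ_eq x y : edge C x y -> succ x = y.
Proof. by move=> edge_xy; apply: funC (edge_succ edge_xy) edge_xy. Qed.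

Lemma play_shift x p q j :
  play x p = inr q -> play (inr q) j = play x (p.+1 + j).
Proof.
move=> play_p; elim: j => [|j IHj]; first by rewrite addn0 /= play_p.
by rewrite addnS /= IHj.
Qed.

Lemma continues_shift x p q j :
  play x p = inr q -> continues (inr q) j <-> continues x (p.+1 + j).
Proof.
by move=> play_p; rewrite /continues -addnS !(play_shift _ play_p).
Qed.

Lemma walk_play x r q : walk C x r q ->
  exists N, [/\ play x N = inr q, edge C x (play x 0),
    forall j, j < N -> continues x j
    & rsum (fun j => wt_of (play x j)) N.+1 = r].
Proof.
elim=> [{}x {}q edge_xq|{}x q1 {}r {}q edge_xq _ [N [playN edge0 cont sumN]]].
  by exists 0; rewrite /= (succ_eq edge_xq) /= Rplus_0_l.
have play0 : play x 0 = inr q1 by rewrite /= (succ_eq edge_xq).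
exists N.+1; split.
- by rewrite -playN (play_shift _ play0).
- by rewrite play0.
- case=> [_|j ltj]; last by apply/(continues_shift _ play0)/cont.
  by exists q1; split=> //; rewrite -[1]/(1 + 0) -(play_shift _ play0).
- rewrite rsum_shift play0 -sumN /=; congr (_ + _)%R.
  have E j : play x j.+1 = play (inr q1) j by rewrite (play_shift _ play0).
  by congr (_ + _)%R; [apply: rsum_ext => j _|]; rewrite -E.
Qed.

Lemma play_walk x N q :
  edge C x (play x 0) -> (forall j, j < N -> continues x j) ->
  play x N = inr q -> exists r, walk C x r q.
Proof.
move=> edge0; elim: N q => [|N IHN] q cont playN.
  by exists (wt C q); apply: walk1; rewrite -playN.
have [q' [playN' edge']] := cont N (ltnSn N).
have [j ltj|r walk_r] := IHN q' _ playN'; first exact/cont/ltnW.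
exists (r + wt C q)%R; apply: walk_trans walk_r _; apply: walk1.
by rewrite -playN.
Qed.

Lemma den_total x : edge C x (play x 0) -> exists d, den C x d.
Proof.
move=> edge0; case: (classic (forall j, continues x j)) => [cont|].
  have [pq playE] : exists pq, forall j, play x j = inr (pq j).
    exists (fun j => sval (constructive_indefinite_description _ (cont j))).
    by move=> j; case: constructive_indefinite_description => q [].
  have [p [p' [lt_pp' eq_pq]]] := pigeonhole_nat pq.
  have [r walk_r] := play_walk edge0 (fun j _ => cont j) (playE p).
  have [r' walk_r'] : exists r', walk C (inr (pq p)) r' (pq p).
    have shift := play_shift _ (playE p).
    apply: (@play_walk _ (p' - p.+1)).
    - by rewrite shift addn0; case: (cont p) => q; rewrite playE => -[[<-]].
    - by move=> j _; apply/(continues_shift _ (playE p)).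
    - by rewrite shift subnKC // playE -eq_pq.
  by exists (cycle_den _ r'); apply: den_cycle walk_r walk_r'.
(* The entry at the least index where the play does not continue is an exit or a dead position; the
   entries before it form a walk. *)
case/least_counterexample => N [ncont cont].
case playN: (play x N) => [k|q].
  case: N => [|N] in ncont cont playN *.
    by exists (Tplain k); apply: den_plain; rewrite -playN.
  have [q' [playN' edge']] := cont N (ltnSn N).
  have [j ltj|r walk_r] := @play_walk x N q' edge0 _ playN'.
    exact/cont/ltnW.
  by exists (Tw r k); apply: den_exit walk_r _; rewrite -playN.
have [r walk_r] := play_walk edge0 cont playN.
exists (dead_den _ (rl C q)); apply: den_dead walk_r _ => -[y edge_qy].
apply: ncont; exists q; split=> //=; rewrite playN.
exact: edge_succ edge_qy.
Qed.

(** [play] starts at index 0, whereas plays in the sense of [is_fin_play] start at index 1; hence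
    [j.-1] and [M.+1]. *)
Lemma play_fin i M : edge C (inl i) (play (inl i) 0) ->
  (forall j, j < M -> continues (inl i) j) -> ~ continues (inl i) M ->
  is_fin_play C i M.+1 (fun j => play (inl i) j.-1).
Proof.
move=> edge0 cont ncont; split=> //; split=> //; split.
  by case=> // j /= ltj; apply: cont.
move=> [q [y /= [playM edge_qy]]]; apply: ncont; exists q; split=> //=.
rewrite playM; exact: edge_succ edge_qy.
Qed.

Lemma den_play_den i d : den C (inl i) d -> play_den C i d.
Proof.
case=> [k edge_ik|r q k walk_q edge_qk|r q walk_q deadq|r q r' walk_q cyc].
- have play0 : play (inl i) 0 = inl k := succ_eq edge_ik.
  left; exists 1, (fun j => play (inl i) j.-1); split.
    by apply: play_fin; rewrite ?play0 // => -[q [playq _]]; rewrite play0 in playq.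
  by rewrite /fin_den play0.
- have [N [playN edge0 cont sumN]] := walk_play walk_q.
  have playS : play (inl i) N.+1 = inl k by rewrite /= playN (succ_eq edge_qk).
  left; exists N.+2, (fun j => play (inl i) j.-1); split.
    apply: play_fin => // [j|[q' []]]; last by rewrite playS.
    rewrite ltnS leq_eqVlt => /orP[/eqP->|]; last exact: cont.
    by exists q; rewrite playS.
  by rewrite /fin_den -[_.-1]/(N.+1) playS -sumN.
- have [N [playN edge0 cont sumN]] := walk_play walk_q.
  left; exists N.+1, (fun j => play (inl i) j.-1); split.
    apply: play_fin => // -[q' [playN' edge']]; apply: deadq.
    by move: playN'; rewrite playN => -[->]; exists (play (inl i) N.+1).
  by rewrite /fin_den playN.
have [N [playN edge0 cont _]] := walk_play walk_q.
have [c [playc edgeq contc sumc]] := walk_play cyc.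
have shift := play_shift _ playN.
(* The play is at [q] at index [N] and again at [N.+1 + c], so a lap takes [c.+1] steps. *)
have per t : N.+1 <= t -> play (inl i) (t + c.+1) = play (inl i) t.
  move=> le_t; rewrite -(subnKC le_t) -addnA -!shift.
  by rewrite addnC -(play_shift _ playc).
(* Indices before [q] and in the first lap are covered by the two walks; a later index is moved back
   by one lap. *)
have cont_all j : continues (inl i) j.
  elim/ltn_ind: j => j IHj.
  case: (ltngtP j N) => [|ltNj|->]; first exact: cont.
    case: (ltngtP (j - N.+1) c) => [lt_c|gt_c|eq_c].
    - by rewrite -(subnKC ltNj); apply/(continues_shift _ playN)/contc.
    - have le_cj : c.+1 <= j - N.+1 by [].
      have le_cj' : c.+1 <= j by apply: leq_trans le_cj (leq_subr _ _).
      have le_Nj : N.+1 <= j - c.+1.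
        by rewrite leq_subRL // addnC -leq_subRL.
      have [|q' [play' edge']] := IHj (j - c.+1).
        by rewrite ltn_subrL (leq_trans _ le_cj').
      exists q'; rewrite -(subnK le_cj') per //; split=> //.
      by rewrite -addSn per // (leq_trans le_Nj).
    - exists q; rewrite -(subnKC ltNj) eq_c -shift playc; split=> //.
      by rewrite -addnS -shift /= playc.
  by exists q; rewrite playN -[N.+1]addn0 -shift.
right; exists (fun j => play (inl i) j.-1); split.
  by split=> // -[|j] // _; apply: cont_all.
have MPiff : MP_cond (fun j => wt_of (play (inl i) j.-1)) <-> (0 <= r')%R.
  have -> : r' = rsum (fun j => wt_of (play (inl i) (N.+1 + j)%nat)) c.+1.
    by rewrite -sumc; apply: rsum_ext => j _; rewrite shift.
  apply: (@MP_cond_subseq _ (fun t => wt_of (play (inl i) t)) N.+1 c.+1 (fun N => N)) => //.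
  by move=> t le_t; rewrite per.
rewrite /cycle_den; case: Rle_dec => r'_ge0; [left|right]; split=> //.
  exact/MPiff.
by move/MPiff.
Qed.

End Play.

(** * Uniqueness of plays and the value of [W] *)

Lemma fin_play_agree m n (C : roG m n) i M s s' :
  functional_edge C -> is_fin_play C i M s -> edge C (inl i) (s' 1) ->
  (forall j, 1 <= j < M -> forall q, s' j = inr q -> edge C (inr q) (s' j.+1)) ->
  forall j, 1 <= j <= M -> s j = s' j.
Proof.
(* The sequence [s'] merely follows edges below [M], so it may be a finite play of another length or
   an infinite play. *)
move=> funC [M_gt0 [edge1 [cont _]]] edge1' cont'.
elim=> // -[|j] IHj lt_jM; first exact: funC edge1 edge1'.
have [q [eq_s edge_s]] := cont j.+1 lt_jM.
apply: (funC _ _ _ edge_s); apply: cont' => //.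
by rewrite -IHj; last exact: (ltnW lt_jM).
Qed.

Lemma fin_play_length m n (C : roG m n) i M s M' s' :
  functional_edge C -> is_fin_play C i M s -> is_fin_play C i M' s' -> M <= M'.
Proof.
move=> funC playM playM'; rewrite leqNgt; apply/negP => lt_M'M.
have [_ [edge1 [cont _]]] := playM; have [M'_gt0 [edge1' [cont' stop']]] := playM'.
apply: stop'; have [|q [eq_s edge_s]] := cont M'; first by rewrite M'_gt0.
exists q, (s M'.+1); split=> //; rewrite -eq_s.
apply: (fin_play_agree funC playM') => //; last by rewrite leqnn M'_gt0.
move=> j /andP[j_gt0 lt_j] q' eq_q'.
have [|q'' []] := cont j; first by rewrite j_gt0 (ltn_trans lt_j).
by rewrite eq_q' => -[->].
Qed.

Lemma fin_inf_play m n (C : roG m n) i M s s' :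
  functional_edge C -> is_fin_play C i M s -> is_inf_play C i s' -> False.
Proof.
move=> funC playM [edge1' cont'].
have [M_gt0 [_ [_ stop]]] := playM; apply: stop.
have [q [eq_s edge_s]] := cont' M M_gt0.
exists q, (s' M.+1); split=> //; rewrite -eq_s.
apply: (fin_play_agree funC playM) => //; last by rewrite leqnn M_gt0.
move=> j /andP[j_gt0 _] q' eq_q'.
by have [q'' []] := cont' j j_gt0; rewrite eq_q' => -[->].
Qed.

Lemma inf_play_agree m n (C : roG m n) i s s' :
  functional_edge C -> is_inf_play C i s -> is_inf_play C i s' ->
  forall j, s j.+1 = s' j.+1.
Proof.
move=> funC [edge1 cont] [edge1' cont']; elim=> [|j IHj]; first exact: funC edge1 edge1'.
have [q [eq_s edge_s]] := cont j.+1 isT.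
have [q' [eq_s' edge_s']] := cont' j.+1 isT.
apply: (funC _ _ _ edge_s).
by move: eq_s; rewrite IHj eq_s' => -[<-].
Qed.

Lemma play_den_unique m n (C : roG m n) i d d' :
  functional_edge C -> play_den C i d -> play_den C i d' -> d = d'.
Proof.
move=> funC [[M [s [playM ->]]]|[s [plays den_s]]]
  [[M' [s' [playM' ->]]]|[s' [plays' den_s']]].
- have eqM : M = M'.
    apply/eqP; rewrite eqn_leq (fin_play_length funC playM playM').
    exact: fin_play_length funC playM' playM.
  rewrite -eqM in playM' *.
  have [M_gt0 [edge1' [cont' _]]] := playM'.
  have agree : forall j, 1 <= j <= M -> s j = s' j.
    apply: (fin_play_agree funC playM) => // j /cont' [q' [-> edge']] q [<-] //.
  rewrite /fin_den agree ?leqnn ?M_gt0 //; case: (s' M) => // k.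
  case: eqP => // _; congr Tw; apply: rsum_ext => j lt_j; rewrite agree //.
  by rewrite /= (leq_trans lt_j) // leq_pred.
- by case: (fin_inf_play funC playM plays').
- by case: (fin_inf_play funC playM' plays).
have agree := inf_play_agree funC plays plays'.
have MPss' : MP_cond (fun j => wt_of (s j)) -> MP_cond (fun j => wt_of (s' j)).
  by apply: MP_cond_ext => t; rewrite agree.
have MPs's : MP_cond (fun j => wt_of (s' j)) -> MP_cond (fun j => wt_of (s j)).
  by apply: MP_cond_ext => t; rewrite agree.
by case: den_s den_s' => [[? ->]|[? ->]] [[? ->]|[? ->]] //; tauto.
Qed.

Lemma den_W m n (C : roG m n) i d :
  functional_edge C -> den C (inl i) d -> W C i = d.
Proof.
(* The choice function [succ] needs an inhabitant of its codomain; every derivation of [den]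
   mentions one. *)
move=> funC den_d; have [y0] : inhabited ('I_n + pos C).
  by case: den_d => [k _|r q *|r q *|r q *]; constructor; [left|right|right|right].
have play_d := den_play_den y0 funC den_d.
exact: play_den_unique funC (epsilon_spec _ _ (ex_intro _ d play_d)) play_d.
Qed.

Lemma W_den m n (C : roG m n) i : is_roPG C -> den C (inl i) (W C i).
Proof.
move=> [/(_ i) [y0 edge_iy] [funC _]].
have [d den_d] := @den_total _ _ _ y0 _ (edge_succ y0 edge_iy).
by rewrite (den_W funC den_d).
Qed.

Lemma denP m n (C : roG m n) x d : den C x d ->
  match d with
  | Tplain k => edge C x (inl k)
  | Tw r k => exists q, walk C x r q /\ edge C (inr q) (inl k)
  | _ => True
  end.
Proof.
case=> [k|r q k walk_q edge_q|r q _ _|r q r' _ _] //; first by exists q.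
  by case: (rl C q).
by rewrite /cycle_den; case: Rle_dec.
Qed.

(** A plain value [k] at [i] makes entrance [i] the only predecessor of exit [k]; reaching [k] from
    [j] would need another entrance or a position as predecessor. *)
Lemma W_S_arrow m n (C : roG m n) : is_roPG C -> S_arrow (W C).
Proof.
move=> roC i k Wi j neq_ji; have [_ [_ injC]] := roC.
have := denP (W_den i roC); rewrite Wi => edge_ik.
have edge_j := denP (W_den j roC).
split=> [Wj|r Wj]; rewrite Wj in edge_j.
  by apply: neq_ji; case: (injC _ _ _ edge_ik edge_j).
by case: edge_j => q [_ /(injC _ _ _ edge_ik)].
Qed.

(** * Simulations of play graphs *)

Section Simulation.
Variables (m n m' n' : nat) (C : roG m n) (C' : roG m' n').
Variables (h : pos C -> pos C') (g : 'I_n -> T 'I_n').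

(** Exits are sent to denotations rather than exits: a play leaving [C] may go on in [C'], so
    composition is covered along with isomorphisms and sums. *)
Definition simulates (x : 'I_m + pos C) (x' : 'I_m' + pos C') : Prop :=
  (forall q, edge C x (inr q) -> edge C' x' (inr (h q))) /\
  (forall k, edge C x (inl k) -> den C' x' (g k)).

Hypothesis h_rl : forall q, rl C' (h q) = rl C q.
Hypothesis h_wt : forall q, wt C' (h q) = wt C q.
Hypothesis h_sim : forall q, simulates (inr q) (inr (h q)).
Hypothesis h_dead : forall q, dead q -> dead (h q).

Lemma walk_sim x x' r q :
  simulates x x' -> walk C x r q -> walk C' x' r (h q).
Proof.
move=> sim_x walk_q; elim: walk_q x' sim_x => [{}x {}q edge_xq|
  {}x q1 {}r {}q edge_xq _ IH] x' [sim_x _]; rewrite -h_wt.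
  exact: walk1 (sim_x _ edge_xq).
exact: walkS (sim_x _ edge_xq) (IH _ (h_sim q1)).
Qed.

Lemma den_sim x x' d : simulates x x' -> den C x d -> den C' x' (Tbind d g).
Proof.
move=> sim_x [k edge_xk|r q k walk_q edge_qk|r q walk_q deadq|r q r' walk_q cyc].
- by case: sim_x => _; apply.
- apply: den_wadd (walk_sim sim_x walk_q) _.
  by case: (h_sim q) => _; apply.
- have := den_dead (walk_sim sim_x walk_q) (h_dead deadq).
  by rewrite h_rl; case: (rl C q).
have := den_cycle (walk_sim sim_x walk_q) (walk_sim (h_sim q) cyc).
by rewrite /cycle_den; case: Rle_dec.
Qed.

End Simulation.

Lemma Tbind_plain (X Y : Type) (h : X -> Y) (d : T X) :
  Tbind d (fun k => Tplain (h k)) = Tmap h d.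
Proof. by case: d. Qed.

Lemma Tmap_id (X : Type) (d : T X) : Tmap (fun k => k) d = d.
Proof. by case: d. Qed.

Lemma sum_map_inj (A A' B B' : Type) (f : A -> A') (g : B -> B') :
  injective f -> injective g -> injective (sum_map f g).
Proof. by move=> injf injg [a|b] [a'|b'] //= [] => [/injf->|/injg->]. Qed.

(** * Isomorphisms, identities and symmetries *)

Lemma W_iso m n (C C' : roG m n) :
  is_roPG C -> is_roPG C' -> ro_iso C C' -> W C = W C'.
Proof.
move=> roC [_ [funC' _]] [h [[h' hK h'K] [edge_h [rl_h wt_h]]]].
apply: functional_extensionality => i; apply/esym/den_W => //.
rewrite -[W C i]Tmap_id -Tbind_plain.
have sim x x' : x' = sum_map (fun i : 'I_m => i) h x ->
    simulates h (fun k => Tplain k) x x'.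
  move=> ->; split=> [q /edge_h //|k /edge_h]; exact: den_plain.
apply: (den_sim rl_h wt_h _ _ _ (W_den i roC)) => [q|q deadq [y]|]; try exact: sim.
move=> edge_y; apply: deadq; exists (sum_map (fun k => k) h' y).
by apply/edge_h; case: y edge_y => //= q'; rewrite h'K.
Qed.

Lemma W_id m : W (ro_id m) = s_id m.
Proof.
apply: functional_extensionality => i; apply: den_W.
  by move=> x y y' [j [-> ->]] [j' [[->] ->]].
by apply: den_plain; exists i.
Qed.

Lemma W_sigma m n : W (ro_sigma m n) = s_sigma m n.
Proof.
apply: functional_extensionality => i; apply: den_W.
  move=> x y y' [[j [-> ->]]|[j [-> ->]]] [[j' [[eq_j] ->]]|[j' [[eq_j] ->]]].
  - by rewrite (ord_inj eq_j).
  - by have := ltn_ord j; rewrite eq_j ltnNge leq_addr.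
  - by have := ltn_ord j'; rewrite -eq_j ltnNge leq_addr.
  - by move/addnI: eq_j => /ord_inj->.
rewrite /s_sigma; case: split_ordP => j ->; apply: den_plain.
  by left; exists j.
by right; exists j.
Qed.

(** * Sequential composition *)

Section Composition.
Variables (m l n : nat) (C : roG m l) (D : roG l n).
Hypotheses (roC : is_roPG C) (roD : is_roPG D).

Let inC := sum_map (fun i : 'I_m => i) (fun q : pos C => @inl (pos C) (pos D) q).

Lemma inC_inj : injective inC.
Proof. by apply: sum_map_inj => // q q' []. Qed.

Lemma inC_neq x q : inC x <> inr (inr q).
Proof. by case: x. Qed.

Lemma ro_comp_functional : functional_edge (ro_comp C D).
Proof.
have [_ [funC _]] := roC; have [_ [funD _]] := roD.
move=> s y y'.
move=> [[x [q [-> [-> e]]]]|[[q [z [-> [-> e]]]]|[x [z [j [-> [-> [e1 e2]]]]]]]];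
  move=> [[x' [q' [eq_x [-> e']]]]|[[q' [z' [eq_x [-> e']]]]|
    [x' [z' [j' [eq_x [-> [e1' e2']]]]]]]].
- by move/inC_inj: eq_x e' => <- /(funC _ _ _ e) [->].
- by case: (inC_neq eq_x).
- by move/inC_inj: eq_x e1' => <- /(funC _ _ _ e).
- by case: (inC_neq (esym eq_x)).
- by case: eq_x e' => <- /(funD _ _ _ e) ->.
- by case: (inC_neq (esym eq_x)).
- by move/inC_inj: eq_x e' => <- /(funC _ _ _ e1).
- by case: (inC_neq eq_x).
move/inC_inj: eq_x e1' => <- /(funC _ _ _ e1) [eq_j].
by rewrite -eq_j in e2'; rewrite (funD _ _ _ e2 e2').
Qed.

(** In the composite, [inC x] inherits the successor of entrance [j] of [D] and therefore simulates
    it. *)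
Lemma den_comp_right x j : edge C x (inl j) ->
  den (ro_comp C D) (inC x) (W D j).
Proof.
move=> edge_xj; rewrite -[W D j]Tmap_id -Tbind_plain.
apply: (@den_sim _ _ _ _ D (ro_comp C D) inr _ _ _ _ _ _ _ _ _ (W_den j roD)) => //.
- move=> q; split=> [q' e|k e]; first by right; left; exists q, (inr q').
  by apply: den_plain; right; left; exists q, (inl k).
- move=> q deadq [y]; case=> [[x' [q' [/esym/inC_neq]]]|] //.
  case=> [[q' [z [[<-] [_ e]]]]|[x' [z [j' [/esym/inC_neq]]]]] //.
  by apply: deadq; exists z.
- split=> [q' e|k e]; first by right; right; exists x, (inr q'), j.
  by apply: den_plain; right; right; exists x, (inl k), j.
Qed.

Lemma W_comp : W (ro_comp C D) = s_comp (W C) (W D).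
Proof.
apply: functional_extensionality => i.
apply: (den_W ro_comp_functional).
have sim x : simulates (C' := ro_comp C D) inl (W D) x (inC x).
  split=> [q e|k e]; last exact: den_comp_right.
  by left; exists x, q.
apply: (@den_sim _ _ _ _ C (ro_comp C D) inl (W D) _ _ _ _ (inl i) (inl i) _ _ (W_den i roC)) => [//|//|||].
- exact: (fun q => sim (inr q)).
- move=> q deadq [y]; case=> [[x [q' [eq_q [_ e]]]]|].
    by apply: deadq; exists (inr q'); case: x eq_q e => // _ [<-].
  case=> [[q' [z [//]]]|[x [z [j [eq_q [_ [e _]]]]]]].
  by apply: deadq; exists (inl j); case: x eq_q e => // _ [<-].
- exact: (sim (inl i)).
Qed.

End Composition.

(** * Monoidal product *)

Section Sum.
Variables (m n m' n' : nat) (C : roG m n) (D : roG m' n').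
Hypotheses (roC : is_roPG C) (roD : is_roPG D).

Lemma ro_oplus_functional : functional_edge (ro_oplus C D).
Proof.
have [_ [funC _]] := roC; have [_ [funD _]] := roD.
have neq x x' : sum_map (fun i : 'I_m => lshift m' i) (@inl (pos C) (pos D)) x <>
    sum_map (fun i => rshift m i) inr x'.
  case: x x' => [i|q] [i'|q'] //= [eq_i].
  by have := ltn_ord i; rewrite eq_i ltnNge leq_addr.
move=> s y y' [[x [z [-> [-> e]]]]|[x [z [-> [-> e]]]]]
  [[x' [z' [eq_x [-> e']]]]|[x' [z' [eq_x [-> e']]]]].
- move/sum_map_inj: eq_x e' => <- //; first by move/(funC _ _ _ e) => ->.
    exact: lshift_inj.
  by move=> ? ? [].
- by case: (neq _ _ eq_x).
- by case: (neq _ _ (esym eq_x)).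
- move/sum_map_inj: eq_x e' => <- //; first by move/(funD _ _ _ e) => ->.
    exact: rshift_inj.
  by move=> ? ? [].
Qed.

Lemma W_oplus : W (ro_oplus C D) = s_oplus (W C) (W D).
Proof.
apply: functional_extensionality => i; apply: (den_W ro_oplus_functional).
rewrite /s_oplus; case: split_ordP => j ->; rewrite -Tbind_plain.
- have sim x : simulates (C' := ro_oplus C D) inl (fun k => Tplain (lshift n' k))
      x (sum_map (fun i => lshift m' i) inl x).
    split=> [q e|k e]; first by left; exists x, (inr q).
    by apply: den_plain; left; exists x, (inl k).
  apply: (@den_sim _ _ _ _ C (ro_oplus C D) inl _ _ _ _ _ _ _ _ _ (W_den j roC)) => [//|//|||].
  + exact: (fun q => sim (inr q)).
  + move=> q deadq [y] [[x [z [eq_q [_ e]]]]|[[?|?] [z [//]]]].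
    by apply: deadq; exists z; case: x eq_q e => // _ [<-].
  + exact: (sim (inl j)).
- have sim x : simulates (C' := ro_oplus C D) inr (fun k => Tplain (rshift n k))
      x (sum_map (fun i => rshift m i) inr x).
    split=> [q e|k e]; first by right; exists x, (inr q).
    by apply: den_plain; right; exists x, (inl k).
  apply: (@den_sim _ _ _ _ D (ro_oplus C D) inr _ _ _ _ _ _ _ _ _ (W_den j roD)) => [//|//|||].
  + exact: (fun q => sim (inr q)).
  + move=> q deadq [y] [[[?|?] [z [//]]]|[x [z [eq_q [_ e]]]]].
    by apply: deadq; exists z; case: x eq_q e => // _ [<-].
  + exact: (sim (inl j)).
Qed.

End Sum.

(** * Enumerating the weighted indices *)

Lemma rsum_constant_tail (b : nat -> R) p c :
  (forall j, j < c -> b (p + j) = 0%R) -> rsum b (p + c) = rsum b p.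
Proof.
elim: c => [|c IHc] zero; first by rewrite addn0.
rewrite addnS /= zero // IHc; first lra.
by move=> j ltj; apply/zero/ltnW.
Qed.

Lemma incr_enum_mono (phi : nat -> nat) :
  (forall t, phi t < phi t.+1) -> {mono phi : s t / s < t}.
Proof.
move=> incr; apply: leqW_mono; apply: leq_mono.
by apply: homo_ltn incr => x y z; apply: ltn_trans.
Qed.

Lemma incr_enum_ge (phi : nat -> nat) :
  (forall t, phi t < phi t.+1) -> forall t, t <= phi t.
Proof. by move=> incr; elim=> // t IHt; apply: leq_ltn_trans IHt _. Qed.

Lemma infinite_pred_enum (P : pred nat) :
  (forall K, exists j, (K <= j) && P j) ->
  exists phi : nat -> nat, (forall t, phi t < phi t.+1) /\
    forall j, P j <-> exists t, phi t = j.
Proof.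
move=> unb; pose nxt K := ex_minn (unb K).
have nxtP K : [/\ K <= nxt K, P (nxt K) & forall j, K <= j -> P j -> nxt K <= j].
  rewrite /nxt; case: ex_minnP => j /andP[leKj Pj] min_j; split=> // j' lej' Pj'.
  by apply: min_j; rewrite lej'.
pose phi := fix phi t := if t is t'.+1 then nxt (phi t').+1 else nxt 0.
have incr t : phi t < phi t.+1 by case: (nxtP (phi t).+1).
exists phi; split=> // j; split=> [Pj|[[|t] <-]]; last first.
- by case: (nxtP (phi t).+1).
- by case: (nxtP 0).
have ex_t : exists t, j <= phi t by exists j; apply: incr_enum_ge.
case: (ex_minnP ex_t) => t le_j min_t; exists t; apply/eqP.
rewrite eqn_leq le_j andbT; case: t le_j min_t => [|t] le_j min_t.
  by case: (nxtP 0) => _ _; apply.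
case: (nxtP (phi t).+1) => _ _; apply=> //; rewrite ltnNge; apply/negP => le_jt.
by have := min_t _ le_jt; rewrite ltnn.
Qed.

(** The indices below [phi N] that satisfy [P] are exactly [phi 0], ..., [phi (N - 1)]; all other
    terms vanish. *)
Lemma rsum_enum (b : nat -> R) (P : pred nat) (phi : nat -> nat) N :
  (forall t, phi t < phi t.+1) -> (forall j, P j <-> exists t, phi t = j) ->
  (forall j, ~~ P j -> b j = 0%R) ->
  rsum (fun t => b (phi t)) N = rsum b (phi N).
Proof.
move=> incr enum zero; have mono := incr_enum_mono incr.
elim: N => [|N IHN] /=.
  rewrite -[phi 0]add0n rsum_constant_tail // => j ltj; apply: zero.
  apply/negP => /enum[t eq_t].
  have : phi t < phi 0 by rewrite eq_t.
  by rewrite mono.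
rewrite IHN -(subnKC (incr N)) rsum_constant_tail //= => j ltj.
apply: zero; apply/negP => /enum[t eq_t].
have : phi N < phi t by rewrite eq_t addSn ltnS leq_addr.
have : phi t < phi N.+1 by rewrite eq_t -ltn_subRL.
by rewrite !mono ltnS leqNgt => /negP.
Qed.

(** * Trace sequences of arrows *)

Section TraceSequence.
Variables (l m n : nat) (f : Sarr (l + m) (l + n)) (i : 'I_m).

(* The entrance at which f is evaluated to produce the j-th entry of the
   sequence tv; junk once the sequence has stopped. *)
Definition tv_src (j : nat) : 'I_(l + m) :=
  match j with
  | 0 => rshift l i
  | j'.+1 => match tv f i j' with
             | Some v => match s_cont v with
                         | Some a => lshift m a
                         | None => rshift l i
                         end
             | None => rshift l i
             end
  end.

Lemma tv_srcE j v : tv f i j = Some v -> v = f (tv_src j).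
Proof.
case: j => [[<-]|j] //=.
by case: (tv f i j) => // v'; case: (s_cont v') => // a [<-].
Qed.

Lemma tvS j v : tv f i j.+1 = Some v ->
  exists a, [/\ tv f i j = Some (f (tv_src j)), s_cont (f (tv_src j)) = Some a,
    tv_src j.+1 = lshift m a & v = f (lshift m a)].
Proof.
rewrite /=; case E: (tv f i j) => [v'|] //; rewrite -(tv_srcE E).
by case: (s_cont v') => // a [<-]; exists a.
Qed.

Lemma tv_after_stop K v : tv f i K = Some v -> s_cont v = None ->
  forall j, K < j -> tv f i j = None.
Proof.
move=> tvK stop; elim=> // j IHj; rewrite ltnS leq_eqVlt => /orP[/eqP <-|ltKj].
  by rewrite /= tvK stop.
by rewrite /= IHj.
Qed.

Lemma s_trace_rel_unique d d' : s_trace_rel f i d -> s_trace_rel f i d' -> d = d'.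
Proof.
have fin_inf K v : tv f i K = Some v -> s_cont v = None ->
    (forall K, exists v a, tv f i K = Some v /\ s_cont v = Some a) -> False.
  move=> tvK stop /(_ K) [v' [a [tvK' cont]]].
  by move: tvK' cont; rewrite tvK => -[<-]; rewrite stop.
move=> [[K [v [tvK [stop ->]]]]|[inf den_d]] [[K' [v' [tvK' [stop' ->]]]]|[inf' den_d']].
- have eqK : K = K'.
    case: (ltngtP K K') => // lt_K.
      by rewrite (tv_after_stop tvK stop lt_K) in tvK'.
    by rewrite (tv_after_stop tvK' stop' lt_K) in tvK.
  by move: tvK'; rewrite -eqK tvK => -[->].
- by case: (fin_inf _ _ tvK stop).
- by case: (fin_inf _ _ tvK' stop').
by case: den_d den_d' => [[? ->]|[? ->]] [[? ->]|[? ->]]; tauto.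
Qed.

Lemma s_trace_eq d : s_trace_rel f i d -> s_trace f i = d.
Proof.
move=> rel_d.
exact: s_trace_rel_unique (epsilon_spec _ _ (ex_intro _ d rel_d)) rel_d.
Qed.

Hypothesis arrow_f : S_arrow f.
Hypothesis inf : forall K, exists v a, tv f i K = Some v /\ s_cont v = Some a.

Lemma inf_tvE j : tv f i j = Some (f (tv_src j)).
Proof. by have [v [a [tvj _]]] := inf j; rewrite tvj -(tv_srcE tvj). Qed.

Lemma inf_contE j : exists2 a, s_cont (f (tv_src j)) = Some a
  & tv_src j.+1 = lshift m a.
Proof.
have [a [_ cont src _]] := tvS (inf_tvE j.+1).
by exists a.
Qed.

(** Each entrance determines the next one, so one repetition forces periodicity. *)
Lemma tv_src_periodic p c : tv_src p = tv_src (p + c) ->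
  forall j, p <= j -> tv_src (j + c) = tv_src j.
Proof.
move=> eq_src; elim=> [|j IHj].
  by rewrite leqn0 => /eqP p0; rewrite -p0 -eq_src.
rewrite leq_eqVlt => /orP[/eqP <-|]; first by rewrite -eq_src.
rewrite ltnS => /IHj eq_j.
have [a conta ->] := inf_contE j; have [b contb] := inf_contE (j + c).
by rewrite addSn => ->; move: contb; rewrite eq_j conta => -[->].
Qed.

Lemma s_contP (v : T 'I_(l + n)) a : s_cont v = Some a ->
  v = Tplain (lshift n a) \/ exists r, v = Tw r (lshift n a).
Proof.
case: v => [k|r k||] //=; case: split_ordP => // b -> [->]; first by left.
by right; exists r.
Qed.

(* A tail of unweighted entries would close an unweighted cycle; exits with an
   unweighted predecessor have no other one, so this cycle would extend
   backwards to the start, which is not an entrance of the feedback loop. *)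
Lemma tv_weighted_unbounded K :
  exists j, (K <= j) && is_weighted (tv f i j).
Proof.
apply: NNPP => none.
have plain j a : K <= j -> s_cont (f (tv_src j)) = Some a ->
    f (tv_src j) = Tplain (lshift n a).
  move=> leKj /s_contP[//|[r fj]]; case: none; exists j.
  by rewrite leKj inf_tvE fj.
(* Sampling at multiples of [K.+1] yields a period [c > K], so that index [p + c] lies in the
   unweighted tail for every [p], down to 0. *)
have [s [t [lt_st eq_st]]] := pigeonhole_nat (fun t => tv_src (t * K.+1)).
have [c lt_c eq_c] : exists2 c, K < c & t * K.+1 = s * K.+1 + c.
  exists ((t - s) * K.+1); last by rewrite -mulnDl subnKC // ltnW.
  by rewrite leq_pmull // subn_gt0.
have back p : tv_src p = tv_src (p + c) -> tv_src 0 = tv_src c.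
  elim: p => [//|p IHp]; rewrite addSn => eq_p; apply: IHp; apply: NNPP => neq.
  have [a conta srca] := inf_contE p; have [b contb srcb] := inf_contE (p + c).
  have eq_ab : a = b by apply: (@lshift_inj l m); rewrite -srca -srcb.
  rewrite -eq_ab in contb.
  have plainb := plain _ _ (leq_trans (ltnW lt_c) (leq_addl p c)) contb.
  have [not_plain not_w] := arrow_f plainb neq.
  by case: (s_contP conta) => [|[r]]; [apply: not_plain|apply: not_w].
rewrite eq_c in eq_st; move/back: eq_st.
case: c lt_c {eq_c back} => // c _; have [a _ ->] := inf_contE c.
by move/esym/eqP; rewrite eq_lrshift.
Qed.

Lemma is_weightedN X (o : option (T X)) : ~~ is_weighted o -> wtT o = 0%R.
Proof. by case: o => [[]|]. Qed.

Lemma s_trace_rel_cycle p c : 0 < c -> tv_src p = tv_src (p + c) ->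
  s_trace_rel f i (cycle_den _ (rsum (fun j => wtT (tv f i (p + j))) c)).
Proof.
move=> c_gt0 /tv_src_periodic per; right; split=> //=.
set r := rsum _ c.
(* Stated for every enumeration, since the outcome [Aany] requires refuting all of them. *)
have MPiff phi : enum_weighted f i phi ->
    MP_cond (fun t => wtT (tv f i (phi t.-1))) <-> (0 <= r)%R.
  move=> [incr enum].
  apply: (@MP_cond_subseq _ (fun j => wtT (tv f i j)) p c phi) => //.
  - by move=> t le_pt; rewrite !inf_tvE per.
  - exact: incr_enum_ge.
  - move=> N; apply: (@rsum_enum _ (fun j => is_weighted (tv f i j))) => //.
    by move=> j; apply: is_weightedN.
have [phi enum_phi] : exists phi, enum_weighted f i phi.
  have [phi [incr enum]] :=
    @infinite_pred_enum (fun j => is_weighted (tv f i j)) tv_weighted_unbounded.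
  by exists phi.
rewrite /cycle_den; case: Rle_dec => r_ge0; [left|right]; split=> //.
  by exists phi; split=> //; apply/MPiff.
by move=> [psi [enum_psi]] /(MPiff _ enum_psi).
Qed.

End TraceSequence.

(** * Trace of play graphs *)

Section Trace.
Variables (l m n : nat) (E : roG (l + m) (l + n)).
Hypothesis roE : is_roPG E.

Let hat (x : 'I_m + pos E) : 'I_(l + m) + pos E :=
  sum_map (fun i : 'I_m => rshift l i) (fun q : pos E => q) x.
Let hat' (y : 'I_n + pos E) : 'I_(l + n) + pos E :=
  sum_map (fun k : 'I_n => rshift l k) (fun q : pos E => q) y.

(** No edge target is both a feedback exit and of the form [hat' y], so determinism makes the two
    chains agree link by link and end together. *)
Lemma tr_chain_functional ks ks' x y y' :
  tr_chain x ks (hat' y) -> tr_chain x ks' (hat' y') -> y = y'.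
Proof.
have [_ [funE _]] := roE.
have hat'_inj : injective hat' by apply: sum_map_inj => //; apply: rshift_inj.
have hat'_neq k z : inl (lshift n k) <> hat' z.
  by case: z => [k'|//] [] eq_k; have := ltn_ord k; rewrite eq_k ltnNge leq_addr.
elim: ks ks' x => [|k ks IHks] [|k' ks'] x /=.
- by move=> e /(funE _ _ _ e) /hat'_inj.
- by move=> e [e' _]; case: (hat'_neq k' y); apply: funE e' e.
- by move=> [e' _] e; case: (hat'_neq k y'); apply: funE e' e.
move=> [e chain] [e' chain']; have [/ord_inj eq_k] := funE _ _ _ e e'.
by rewrite -eq_k in chain'; apply: IHks chain chain'.
Qed.

Lemma ro_trace_functional : functional_edge (ro_trace E).
Proof. by move=> x y y' [ks chain] [ks' chain']; apply: tr_chain_functional chain chain'. Qed.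

(** Reachability of [z] from [x] through the feedback loop alone, in continuation form: chains are
    extended at the far end without a concatenation lemma. *)
Definition lead (x : 'I_m + pos E) (z : 'I_(l + m) + pos E) : Prop :=
  forall ks y, tr_chain z ks y -> exists ks', tr_chain (hat x) ks' y.

Lemma lead_refl x : lead x (hat x).
Proof. by move=> ks y; exists ks. Qed.

Lemma lead_step x z a :
  lead x z -> edge E z (inl (lshift n a)) -> lead x (inl (lshift m a)).
Proof. by move=> lead_xz e ks y chain; apply: (lead_xz (a :: ks)). Qed.

Lemma lead_edge x z y :
  lead x z -> edge E z (hat' y) -> edge (ro_trace E) x y.
Proof. by move=> lead_xz e; apply: (lead_xz [::]). Qed.

(** Feedback can enter only through the first step; afterwards every source is a position, and its
    edges to positions are traced edges with an empty chain. *)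
Lemma walk_trace x z r q : walk E z r q -> lead x z -> walk (ro_trace E) x r q.
Proof.
move=> walk_q; elim: walk_q x => [{}z {}q e|{}z q1 {}r {}q e _ IH] x lead_xz.
  exact: (@walk1 _ _ (ro_trace E) x q (lead_edge (y := inr q) lead_xz e)).
apply: (@walkS _ _ (ro_trace E) x q1 r q (lead_edge (y := inr q1) lead_xz e)).
exact/IH/(@lead_refl (inr q1)).
Qed.

Lemma dead_trace q : dead (C := E) q -> dead (C := ro_trace E) q.
Proof.
move=> deadq [y [[|k ks] /=]]; first by move=> e; apply: deadq; eexists; exact: e.
by move=> [e _]; apply: deadq; eexists; exact: e.
Qed.

(* From entrance z the trace sequence of W E reaches entrance z' of the feedback
   loop, visiting positions iff w.  The last visited position q depends on z
   only, so a segment from z to z closes up to a cycle at q. *)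
Definition segment (w : bool) (r : R) (z z' : 'I_(l + m)) : Prop :=
  if w then exists2 q, lead (inr q) (inl z')
                     & forall x, lead x (inl z) -> walk (ro_trace E) x r q
  else r = 0%R /\ forall x, lead x (inl z) -> lead x (inl z').

Lemma segment_trans w r z w' r' z' z'' :
  segment w r z z' -> segment w' r' z' z'' -> segment (w || w') (r + r')%R z z''.
Proof.
case: w; case: w' => /=.
- move=> [q lead_q walk_q] [q' lead_q' walk_q']; exists q' => // x lead_x.
  exact: walk_trans (walk_q _ lead_x) (walk_q' _ lead_q).
- move=> [q lead_q walk_q] [-> lead_z']; rewrite Rplus_0_r.
  by exists q => //; apply: lead_z'.
- move=> [-> lead_z] [q lead_q walk_q]; rewrite Rplus_0_l.
  by exists q => // x /lead_z; apply: walk_q.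
move=> [-> lead_z] [-> lead_z']; split; first by rewrite Rplus_0_l.
by move=> x /lead_z/lead_z'.
Qed.

Lemma den_segment z v a : den E (inl z) v -> s_cont v = Some a ->
  segment (is_weighted (Some v)) (wtT (Some v)) z (lshift m a).
Proof.
move=> den_v /s_contP[eq_v|[r eq_v]]; rewrite eq_v; rewrite eq_v in den_v.
  by split=> // x /lead_step; apply; apply: (denP den_v).
have [q [walk_q edge_q]] := denP den_v.
exists q => [|x]; last exact: walk_trace.
exact: lead_step (@lead_refl (inr q)) edge_q.
Qed.

(** The value of [s_trace_fin] when no weighted entry precedes [v]; otherwise the earlier weight is
    put in front by [wadd]. *)
Definition trace_stop (v : T 'I_(l + n)) : T 'I_n :=
  match v with
  | Tplain k => if fintype.split k is inr b then Tplain b else Eany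
  | Tw r k => if fintype.split k is inr b then Tw r b else Eany
  | Eany => Eany
  | Aany => Aany
  end.

Lemma den_trace_stop x z v : den E z v -> s_cont v = None -> lead x z ->
  den (ro_trace E) x (trace_stop v).
Proof.
case=> [k e|r q k walk_q e|r q walk_q deadq|r q r' walk_q cyc] /= stop lead_x.
- case: split_ordP stop e => // b -> _ e.
  exact: (@den_plain _ _ (ro_trace E)) (lead_edge (y := inl b) lead_x e).
- case: split_ordP stop e => // b -> _ e.
  apply: den_exit (walk_trace walk_q lead_x) _.
  exact: (lead_edge (y := inl b) (@lead_refl (inr q)) e).
- have := den_dead (walk_trace walk_q lead_x) (dead_trace deadq).
  by rewrite /=; case: (rl E q).
have := den_cycle (walk_trace walk_q lead_x) (walk_trace cyc (@lead_refl (inr q))).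
by rewrite /cycle_den; case: Rle_dec.
Qed.

Section FromEntrance.
Variable i : 'I_m.
Let v := tv (W E) i.
Let src := tv_src (W E) i.

Lemma tv_segment p c : v (p + c) <> None ->
  segment (seq.has (fun j => is_weighted (v j)) (seq.iota p c))
    (rsum (fun j => wtT (v (p + j)%nat)) c) (src p) (src (p + c)).
Proof.
elim: c => [|c IHc]; first by rewrite addn0.
rewrite addnS; case E': (v (p + c).+1) => [u|] // _.
have [a [vpc cont srcS _]] := tvS E'.
have -> : seq.iota p c.+1 = seq.iota p c ++ [:: (p + c)] by rewrite -addn1 iotaD.
rewrite (srcS : src _ = _) has_cat /= orbF /v vpc.
apply: segment_trans (IHc _) (den_segment (W_den _ roE) cont).
by rewrite /v vpc.
Qed.

Lemma den_trace_fin K u : v K = Some u -> s_cont u = None ->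
  den (ro_trace E) (inl i) (s_trace_fin (W E) i K u).
Proof.
move=> vK stop.
have : v (0 + K) <> None by rewrite vK.
move/tv_segment; rewrite add0n.
have := W_den (src K) roE; rewrite -(tv_srcE vK) => den_u.
rewrite /s_trace_fin /= -/v vK.
(* The flag of the segment is the test by which [s_trace_fin] decides whether a plain last entry
   becomes weighted. *)
case: seq.has => [[q lead_q walk_q]|[-> lead_i]].
  have := den_wadd (walk_q _ (lead_refl (x := inl i))) (den_trace_stop den_u stop lead_q).
  case: u stop {vK den_u} => [k|r k||] //=; case: fintype.split => //= b _.
  by rewrite Rplus_0_r.
have := den_trace_stop den_u stop (lead_i _ (lead_refl (x := inl i))).
case: u stop {vK den_u} => [k|r k||] //=; case: fintype.split => //= b _.
by rewrite Rplus_0_l.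
Qed.

Hypothesis inf : forall K, exists u a, v K = Some u /\ s_cont u = Some a.

Lemma den_trace_inf :
  exists2 d, den (ro_trace E) (inl i) d & s_trace_rel (W E) i d.
Proof.
have unb := tv_weighted_unbounded (W_S_arrow roE) inf.
have [phi [incr enum]] := infinite_pred_enum unb.
(* Only entrances reached right after a weighted entry are compared: the period then ends with the
   weighted index [phi t'], so its segment passes through a position. *)
have [t [t' [lt_tt' eq_src]]] := pigeonhole_nat (fun t => src (phi t).+1).
have lt_phi : phi t < phi t' by rewrite incr_enum_mono.
set p := (phi t).+1 in eq_src; pose c := phi t' - phi t.
have c_gt0 : 0 < c by rewrite subn_gt0.
have eq_pc : (phi t').+1 = p + c by rewrite addSn subnKC // ltnW.
rewrite eq_pc in eq_src.
have vN j : v j <> None by have [u [a [vj _]]] := inf j; rewrite vj.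
exists (cycle_den _ (rsum (fun j => wtT (v (p + j)%nat)) c)); last first.
  exact (s_trace_rel_cycle (W_S_arrow roE) inf c_gt0 eq_src).
have := @tv_segment p c (vN _).
have -> : seq.has (fun j => is_weighted (v j)) (seq.iota p c).
  apply/hasP; exists (phi t'); last by apply/enum; exists t'.
  by rewrite mem_iota -eq_pc ltnS leqnn andbT.
rewrite -eq_src => -[q lead_q walk_q].
have cyc := walk_q _ lead_q.
have lead_i := lead_refl (x := inl i).
have := @tv_segment 0 p (vN _); case: seq.has => [[q' lead_q' walk_q']|[_ lead_p]].
  exact: den_cycle (walk_trans (walk_q' _ lead_i) (walk_q _ lead_q')) cyc.
exact: den_cycle (walk_q _ (lead_p _ lead_i)) cyc.
Qed.

End FromEntrance.

Lemma W_trace : W (ro_trace E) = s_trace (W E).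
Proof.
apply: functional_extensionality => i.
suff [d den_d rel_d] : exists2 d, den (ro_trace E) (inl i) d
    & s_trace_rel (W E) i d.
  by rewrite (s_trace_eq rel_d) (den_W ro_trace_functional den_d).
case: (classic (forall K, exists u a, tv (W E) i K = Some u /\ s_cont u = Some a)).
  exact: den_trace_inf.
case/least_counterexample => K [ncont cont].
have [u vK] : exists u, tv (W E) i K = Some u.
  case: K cont {ncont} => [|K] cont; first by eexists.
  by have [u [a [vK contu]]] := cont K (ltnSn K); rewrite /= vK contu; eexists.
have stop : s_cont u = None.
  by case contu: (s_cont u) => [a|] //; case: ncont; exists u, a.
exists (s_trace_fin (W E) i K u); first exact: den_trace_fin.
by left; exists K, u.
Qed.

End Trace.

Theorem theorem4p5 :
  (* W is well defined on roPGs up to isomorphism *)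
  (forall (m n : nat) (C C' : roG m n),
      is_roPG C -> is_roPG C' -> ro_iso C C' -> W C = W C') /\
  (* W lands in S^P_r *)
  (forall (m n : nat) (C : roG m n), is_roPG C -> S_arrow (W C)) /\
  (* identities and symmetries *)
  (forall m : nat, W (ro_id m) = s_id m) /\
  (forall m n : nat, W (ro_sigma m n) = s_sigma m n) /\
  (* composition *)
  (forall (m l n : nat) (C : roG m l) (D : roG l n),
      is_roPG C -> is_roPG D -> W (ro_comp C D) = s_comp (W C) (W D)) /\
  (* monoidal product *)
  (forall (m n m' n' : nat) (C : roG m n) (D : roG m' n'),
      is_roPG C -> is_roPG D -> W (ro_oplus C D) = s_oplus (W C) (W D)) /\
  (* trace *)
  (forall (l m n : nat) (E : roG (l + m) (l + n)),
      is_roPG E -> W (ro_trace E) = s_trace (W E)).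
Proof.
split; first exact: W_iso.
split; first exact: W_S_arrow.
split; first exact: W_id.
split; first exact: W_sigma.
split; first exact: W_comp.
split; first exact: W_oplus.
exact: W_trace.
Qed.
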